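(* Let $X_t$ be a regular one-dimensional diffusion as in the context, let $g:D\to\mathbb{R}$ satisfy $g(x_0)>0$ for some $x_0\in(l,r)$, and let $\rho>0$, $p^*\in(l,r)$. The threshold stopping time $\tau^r_{p^*}$ is optimal in the problem $$\sup_{\tau\in\mathcal{M}^r_{\rm th}}\mathbf{E}^x g(X_\tau)e^{-\rho\tau}\mathbf{1}_{\{\tau<\infty\}}$$ for all $x\in(l,r)$ if and only if the following two conditions hold (for $p\in(l,r)$): 1. $g(p)/\varphi(p)\le g(p^* )/\varphi(p^* )$ whenever $p>p^*$; 2. $g(p)/\varphi(p)$ does not decrease (i.e. is non-decreasing) for $p\le p^*$.
   Context: $X_t$, $t\ge0$, is a (continuous) diffusion process with values in an interval $D\subseteq\mathbb{R}$ with boundary points $-\infty\le l<r\le+\infty$ (each endpoint may or may not belong to $D$), with infinitesimal generator $\mathbb{L}f(x)=a(x)f'(x)+\frac12\sigma^2(x)f''(x)$, where $a:D\to\mathbb{R}$, $\sigma:D\to\mathbb{R}_+$. Regularity is guaranteed by the assumption: for every $x\in(l,r)$ there is $\varepsilon>0$ with $\int_{x-\varepsilon}^{x+\varepsilon}\frac{1+|a(y)|}{\sigma^2(y)}dy<\infty$. $\mathbf{E}^x$ denotes expectation for $X_0=x$. $\psi$ and $\varphi$ denote the increasing and the decreasing fundamental solutions (positive and finite on $(l,r)$, with absolutely continuous derivatives, unique up to positive multiplicative constants) of $\mathbb{L}u=\rho u$ a.e. on $(l,r)$ associated with the process $X$; with $T_p=\inf\{t\ge0:X_t=p\}$ they satisfy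 $\mathbf{E}^xe^{-\rho T_p}=\psi(x)/\psi(p)$ for $x<p$ and $\mathbf{E}^xe^{-\rho T_p}=\varphi(x)/\varphi(p)$ for $x\ge p$ ($x,p\in(l,r)$). For $p\in(l,r)$, $\tau_p^r=\inf\{t\ge0: X_t\le p\}$, and $\mathcal{M}^r_{\rm th}=\{\tau^r_p:\ p\in(l,r)\}$. *)

(* Defs.v *)
From HB Require Import structures.
From mathcomp Require Import all_boot all_order all_algebra.
From mathcomp Require Import all_classical all_reals all_analysis measurable_realfun.
Set Implicit Arguments.
Unset Strict Implicit.
Unset Printing Implicit Defensive.
Import Order.TTheory GRing.Theory Num.Theory.
Import numFieldNormedType.Exports.
Local Open Scope ring_scope.
Local Open Scope classical_set_scope.

(* Functions on the state space, and processes indexed by t >= 0, are total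
   functions on R; only their values on D, resp. at nonnegative times, ever
   matter. *)

Section state_space.
Context {R : realType}.
Implicit Types (l r : \bar R) (D : set R) (u a sigma h : R -> R).

Definition open_itv l r : set R := [set x | (l < x%:E < r)%E].

(* Each finite endpoint may or may not belong to D. *)
Definition interval_with_endpoints l r D : Prop :=
  [/\ (l < r)%E, open_itv l r `<=` D & D `<=` [set x | (l <= x%:E <= r)%E]].

Definition abs_continuous_on (al be : R) u : Prop :=
  forall e, 0 < e -> exists2 d, 0 < d &
    forall (n : nat) (s t : 'I_n -> R),
      (forall i, al <= s i /\ s i <= t i /\ t i <= be) ->
      trivIset setT (fun i => `]s i, t i[%classic) ->
      \sum_(i < n) (t i - s i) < d ->
      \sum_(i < n) `|u (t i) - u (s i)| < e.

(* Absolute continuity on an open interval is understood locally. *)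
Definition abs_continuous_derivative l r u : Prop :=
  (forall x, open_itv l r x -> derivable u x 1) /\
  (forall al be, open_itv l r al -> open_itv l r be ->
     abs_continuous_on al be (derive1 u)).

Definition diff_op a sigma u : R -> R := fun x =>
  a x * derive1 u x + 2^-1 * sigma x ^+ 2 * derive1 (derive1 u) x.

Definition diff_op_ae l r a sigma u h : Prop :=
  \forall x \ae (@lebesgue_measure R), open_itv l r x ->
    derivable (derive1 u) x 1 /\ diff_op a sigma u x = h x.

(* The quotient is taken in the extended reals, where 1 / 0 = +oo, so that
   sigma cannot vanish on a set of positive measure. *)
Definition local_integrability l r a sigma : Prop :=
  forall x, open_itv l r x ->
    exists e : R, [/\ 0 < e, `[x - e, x + e] `<=` open_itv l r &
      (\int[lebesgue_measure]_(y in `[(x - e)%R, (x + e)%R])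
         ((1 + `|a y|)%R%:E / (sigma y ^+ 2)%R%:E) < +oo)%E].

Definition continuous_bounded D u : Prop :=
  {within D, continuous u} /\ exists M, forall x, D x -> `|u x| <= M.

Definition compact_support l r D u : Prop :=
  exists al be, [/\ open_itv l r al, open_itv l r be &
    forall x, D x -> ~ (al <= x <= be) -> u x = 0].

End state_space.

Section process.
Context {R : realType} {d : measure_display} {T : measurableType d}.
Implicit Types (D : set R) (X : R -> T -> R) (P : R -> probability T R)
  (tau : T -> \bar R) (f g h : R -> R) (A : set T) (l r : \bar R).

(* sigma (X_s, s <= t); t = +oo gives the whole history. *)
Definition history X (t : \bar R) : set (set T) :=
  <<s [set A | exists s, [/\ 0 <= s, (s%:E <= t)%E &
                 preimage_set_system setT (X s) measurable A]] >>.

(* Stopping times of the right-continuous filtration F_{t+}. *)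
Definition optional_time X tau : Prop :=
  (forall w, (0 <= tau w)%E) /\
  (forall t : R, 0 <= t -> history X t%:E [set w | (tau w < t%:E)%E]).

(* The sigma-algebra F_{tau+}. *)
Definition stopped_history X tau A : Prop :=
  history X +oo%E A /\
  (forall t : R, 0 <= t -> history X t%:E (A `&` [set w | (tau w < t%:E)%E])).

Definition strong_markov D X P : Prop :=
  forall x, D x -> forall tau, optional_time X tau ->
  forall A, stopped_history X tau A ->
  forall u : R, 0 <= u -> forall B : set R, measurable B ->
    P x (A `&` [set w | (tau w < +oo)%E /\ B (X (fine (tau w) + u) w)]) =
    (\int[P x]_(w in A `&` [set w | (tau w < +oo)%E])
       P (X (fine (tau w)) w) (X u @^-1` B))%E.

(* h is the image of f under the infinitesimal generator of the semigroup
   E^x f(X_t) on bounded continuous functions on D with the sup norm. *)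
Definition generator D X P f h : Prop :=
  [/\ continuous_bounded D f, continuous_bounded D h &
    forall e, 0 < e -> \forall t \near 0^'+, forall x, D x ->
      `|(fine 'E_(P x)[f \o X t] - f x) / t - h x| <= e].

(* The generator acts on its domain as L f = a f' + sigma^2 f'' / 2 inside
   (l,r), and its domain contains every compactly supported f for which L f
   makes sense. The behaviour at endpoints belonging to D is left free. As a
   and sigma are only measurable, L f is an almost everywhere expression. *)
Definition has_generator l r D (a sigma : R -> R) X P : Prop :=
  (forall f h, generator D X P f h ->
     abs_continuous_derivative l r f /\ diff_op_ae l r a sigma f h) /\
  (forall f h, {within D, continuous f} -> {within D, continuous h} ->
     compact_support l r D f ->
     abs_continuous_derivative l r f -> diff_op_ae l r a sigma f h ->
     generator D X P f h).

(* P x is the law under which the process starts at x. *)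
Record regular_diffusion l r D (a sigma : R -> R) X P : Prop := {
  diffusion_interval : interval_with_endpoints l r D ;
  diffusion_drift : measurable_fun D a ;
  diffusion_volatility : measurable_fun D sigma ;
  diffusion_volatility_ge0 : forall x, D x -> 0 <= sigma x ;
  diffusion_regular : local_integrability l r a sigma ;
  diffusion_measurable : forall t : R, 0 <= t -> measurable_fun setT (X t) ;
  diffusion_state : forall (t : R) w, 0 <= t -> D (X t w) ;
  diffusion_continuous :
    forall w, {within `[0, +oo[, continuous (fun t => X t w)} ;
  diffusion_start : forall x, D x -> P x (X 0 @^-1` [set x]) = 1%E ;
  diffusion_kernel :
    forall A, history X +oo%E A -> measurable_fun D (fun x => P x A) ;
  diffusion_markov : strong_markov D X P ;
  diffusion_generator : has_generator l r D a sigma X P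
}.

Definition hitting_time X (p : R) : T -> \bar R := fun w =>
  ereal_inf [set t%:E | t in [set t | 0 <= t /\ X t w = p]].

Definition threshold_time X (p : R) : T -> \bar R := fun w =>
  ereal_inf [set t%:E | t in [set t | 0 <= t /\ X t w <= p]].

Definition threshold_times l r X : set (T -> \bar R) :=
  [set threshold_time X p | p in open_itv l r].

(* e^{-rho t}, with e^{-oo} = 0. *)
Definition discount (rho : R) (t : \bar R) : R :=
  if t is s%:E then expR (- (rho * s)) else 0.

(* The solution associated with the process is singled out among the
   decreasing solutions by the Laplace transform of the hitting times. *)
Record decreasing_fundamental_solution l r (a sigma : R -> R) X P
    (rho : R) (phi : R -> R) : Prop := {
  phi_gt0 : forall x, open_itv l r x -> 0 < phi x ;
  phi_decreasing : forall x y, open_itv l r x -> open_itv l r y ->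
    x < y -> phi y < phi x ;
  phi_abs_continuous : abs_continuous_derivative l r phi ;
  phi_equation : diff_op_ae l r a sigma phi (fun x => rho * phi x) ;
  phi_hitting : forall x p, open_itv l r x -> open_itv l r p -> p <= x ->
    ('E_(P x)[fun w => discount rho (hitting_time X p w)]
     = (phi x / phi p)%R%:E)%E
}.

(* E^x g(X_tau) e^{-rho tau} 1_{tau < oo} *)
Definition expected_payoff X P g (rho : R) (x : R) tau : \bar R :=
  ('E_(P x)[fun w => (g (X (fine (tau w)) w) * discount rho (tau w)
                      * \1_[set w' | (tau w' < +oo)%E] w)%R])%E.

Definition optimal_in (M : set (T -> \bar R)) (J : (T -> \bar R) -> \bar R)
    tau : Prop :=
  M tau /\ J tau = ereal_sup (J @` M).

End process.

(* Main.v *)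
Require Import Defs.
From mathcomp Require Import all_boot all_order all_algebra.
From mathcomp Require Import all_classical all_reals all_analysis measurable_realfun.
Import Order.TTheory GRing.Theory Num.Theory.
Import numFieldNormedType.Exports HBNNSimple.
Local Open Scope ring_scope.
Local Open Scope classical_set_scope.

(** By path continuity, starting from x the threshold rule at p pays
    V_p(x) = phi(x) (g/phi)(min(x, p)). Hence p* is optimal from every x iff
    (g/phi)(min(x, p)) <= (g/phi)(min(x, p* )) for all x and p. Taking x = p > p*
    gives condition 1, and x = q with p <= q <= p* gives condition 2; the
    converse is a case analysis on the position of min(x, p). *)

(* The payoff g is an arbitrary function, so the integrands below need not be
   measurable and the library's results on integrals do not apply; the integral
   of a nonnegative function is a supremum over simple functions all the same. *)

Lemma ge0_le_integral_full_set (d : measure_display) (T : measurableType d)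
    (R : realType) (P : probability T R) (A : set T) (f1 f2 : T -> \bar R) :
  measurable A -> P A = 1%E ->
  (forall w, 0 <= f1 w)%E -> (forall w, 0 <= f2 w)%E ->
  (forall w, A w -> f1 w <= f2 w)%E ->
  (\int[P]_w f1 w <= \int[P]_w f2 w)%E.
Proof.
move=> mA PA f10 f20 f12.
rewrite (ge0_integralTE P f10); apply: ge_ereal_sup => _ [h hf1 <-].
have PcA : P (~` A) = 0%E by rewrite probability_setC // PA subee.
(* Cutting [h] off outside [A] changes it only on a null set, and the cut-off lies below [f2]
   everywhere, although [f1 <= f2] is known on [A] alone. *)
have -> : sintegral P h = sintegral P (proj_nnsfun h mA).
  rewrite -!integralT_nnsfun; apply: ae_eq_integral => //.
  - exact/measurable_EFinP.
  - exact/measurable_EFinP.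
  exists (~` A); split => //; first exact: measurableC.
  move=> w /= hw Aw; apply: hw => _.
  by rewrite /= mindicE mem_set // mulr1.
rewrite (ge0_integralTE P f20); apply: ereal_sup_ubound.
exists (proj_nnsfun h mA) => // w /=; rewrite mindicE.
have [wA|_] := boolP (w \in A); last by rewrite mulr0.
by rewrite mulr1 (le_trans (hf1 w)) // f12 //; exact: set_mem.
Qed.

(** The process starts at [x] only with probability one, so payoffs get compared on that event.
    Positive and negative parts are treated separately, each by two inequalities. *)
Lemma eq_expectation_full_set (d : measure_display) (T : measurableType d)
    (R : realType) (P : probability T R) (A : set T) (f1 f2 : T -> R) :
  measurable A -> P A = 1%E -> (forall w, A w -> f1 w = f2 w) ->
  'E_P[f1]%E = 'E_P[f2]%E.
Proof.
move=> mA PA f12; rewrite unlock integralE [RHS]integralE.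
by congr (_ - _)%E; apply/eqP; rewrite eq_le; apply/andP; split;
  apply: (@ge0_le_integral_full_set _ _ _ _ A) => // w Aw;
  rewrite ?funeposE ?funenegE f12.
Qed.

Arguments eq_expectation_full_set {d T R P A f1 f2}.

(** Multiplication by [c] maps the simple functions below [f] onto those below [c * f], with inverse
    multiplication by [c^-1]. *)
Lemma ge0_integralZl_pos (d : measure_display) (T : measurableType d)
    (R : realType) (P : probability T R) (f : T -> \bar R) (c : R) :
  (forall w, 0 <= f w)%E -> 0 < c ->
  (\int[P]_w (c%:E * f w) = c%:E * \int[P]_w f w)%E.
Proof.
move=> f0 c0; rewrite !ge0_integralTE //; last first.
  by move=> w; rewrite mule_ge0 // lee_fin ltW.
rewrite -ereal_sup_pZl //; congr ereal_sup; apply/seteqP; split => [_ [h hf <-]|].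
  have c10 : 0 <= c^-1 by rewrite invr_ge0 ltW.
  exists (sintegral P (scale_nnsfun h c10)).
    exists (scale_nnsfun h c10) => // w /=.
    by rewrite EFinM lee_pdivrMl //; exact: hf.
  by rewrite sintegralrM muleA -(EFinM c) divff ?gt_eqF// mul1e.
move=> _ [_ [h hf <-] <-]; exists (scale_nnsfun h (ltW c0)).
  by move=> w /=; rewrite EFinM lee_pmul2l.
by rewrite sintegralrM.
Qed.

(** The factor [c] will be the reward [g p], which may be negative; in that case [c * f] has zero
    positive part and negative part [- c * f]. *)
Lemma ge0_expectationZl (d : measure_display) (T : measurableType d)
    (R : realType) (P : probability T R) (f : T -> R) (c : R) :
  (forall w, 0 <= f w) ->
  ('E_P[fun w => (c * f w)%R])%E = (c%:E * 'E_P[f])%E.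
Proof.
move=> f0; rewrite unlock.
have f0E w : (0 <= (f w)%:E)%E by rewrite lee_fin.
have [c0|c0|->] := ltgtP c 0; last first.
- by under eq_integral do rewrite mul0r; rewrite integral0 mul0e.
- by under eq_integral do rewrite EFinM; rewrite ge0_integralZl_pos.
rewrite integralE.
under eq_integral => w _.
  rewrite funeposE max_r; last by rewrite lee_fin nmulr_rle0.
  over.
rewrite integral0 sub0e.
under eq_integral => w _.
  rewrite funenegE max_l; last by rewrite -EFinN lee_fin oppr_ge0 nmulr_rle0.
  rewrite -EFinN -mulNr EFinM.
  over.
by rewrite ge0_integralZl_pos ?oppr_gt0 // EFinN mulNe oppeK.
Qed.

Section paths.
Context {R : realType} {d : measure_display} {T : measurableType d}.
Variables (X : R -> T -> R) (p : R) (w : T).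

Lemma threshold_time_start : X 0 w <= p -> threshold_time X p w = 0%E.
Proof.
move=> Xp; apply/eqP; rewrite eq_le; apply/andP; split.
  by apply: ereal_inf_lbound; exists 0.
by apply: le_ereal_inf_tmp => _ [t [t0 _] <-]; rewrite lee_fin.
Qed.

Hypothesis cX : {within `[0, +oo[, continuous (fun t => X t w)}.

(** By the intermediate value theorem, a path that starts at or above [p] and is at or below [p] at
    time [t] has visited [p] by time [t]. *)
Lemma threshold_time_eq_hitting_time : p <= X 0 w ->
  threshold_time X p w = hitting_time X p w.
Proof.
move=> pX; apply/eqP; rewrite eq_le; apply/andP; split.
  by apply: ereal_inf_le_tmp => _ [t [t0 Xt] <-]; exists t => //=; rewrite Xt.
apply: le_ereal_inf_tmp => _ [t [t0 Xt] <-].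
have c0t : {within `[0, t], continuous (fun t => X t w)}.
  apply: continuous_subspaceW cX => s /=.
  by rewrite !in_itv /= => /andP[-> _].
have [|s] := IVT (v := p) t0 c0t; first by rewrite ge_min le_max Xt pX orbT.
rewrite in_itv /= => /andP[s0 st] Xs.
apply: (@le_trans _ _ s%:E); last by rewrite lee_fin.
by apply: ereal_inf_lbound; exists s.
Qed.

Lemma position_at_hitting_time : (hitting_time X p w < +oo)%E ->
  X (fine (hitting_time X p w)) w = p.
Proof.
have h0 : (0 <= hitting_time X p w)%E.
  by apply: le_ereal_inf_tmp => _ [t [t0 _] <-]; rewrite lee_fin.
move=> hoo; have hfin : hitting_time X p w \is a fin_num.
  by rewrite ge0_fin_numE.
set m := fine _; have mE : hitting_time X p w = m%:E by rewrite fineK.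
have m0 : 0 <= m by rewrite -lee_fin -mE.
have cm : X t w @[t --> within `[0, +oo[ (nbhs m)] --> X m w.
  have /subspace_continuousP := cX; apply.
  by rewrite /= in_itv /= m0.
apply/eqP/negPn/negP => Xmp.
(* With the distance to [p] as tolerance, continuity excludes visits to [p] within some [e] of [m],
   whereas the infimum [m] forces a visit in [[m, m + e)]. *)
have e0 : 0 < `|X m w - p| by rewrite normr_gt0 subr_eq0.
move/cvgrPdist_lt : cm => /(_ _ e0); rewrite near_withinE => -[e /= e_gt0 he].
have [|_ [t [t0 Xt] <-]] := @ereal_inf_lt _ [set t%:E | t in [set t | 0 <= t /\ X t w = p]] (m + e)%:E.
  by rewrite -/(hitting_time X p w) mE lte_fin ltrDl.
rewrite lte_fin => tme.
have mt : m <= t.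
  by rewrite -lee_fin -mE; apply: ereal_inf_lbound; exists t.
have := he t; rewrite /= in_itv /= t0 Xt ltxx => H.
apply/notF/H => //.
by rewrite ler0_norm ?subr_le0 // opprB ltrBlDl.
Qed.

End paths.

Lemma discount_ge0 (R : realType) (rho : R) (t : \bar R) : 0 <= discount rho t.
Proof. by case: t => [s| |] //=; rewrite expR_ge0. Qed.

(** For [x <= p] the rule stops at time 0 and pays [g x]. For [p < x] it stops on hitting [p], so
    the payoff is [g p] times the Laplace transform [phi x / phi p]. *)
Lemma expected_payoff_threshold_time (R : realType) (d : measure_display)
    (T : measurableType d) (l r : \bar R) (D : set R) (a sigma : R -> R)
    (X : R -> T -> R) (P : R -> probability T R) (rho : R) (phi g : R -> R)
    (x p : R) :
  regular_diffusion l r D a sigma X P ->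
  decreasing_fundamental_solution l r a sigma X P rho phi ->
  open_itv l r x -> open_itv l r p ->
  expected_payoff X P g rho x (threshold_time X p) =
  (phi x * (g (Num.min x p) / phi (Num.min x p)))%:E.
Proof.
move=> hX hphi lrx lrp; rewrite /expected_payoff.
have [_ sD _] := diffusion_interval hX.
have PA := diffusion_start hX (sD _ lrx).
have mA : measurable (X 0 @^-1` [set x]).
  rewrite -[X in measurable X]setTI.
  exact: (diffusion_measurable hX (lexx 0)).
have [xp|px] := leP x p.
  have phix : phi x != 0 by rewrite gt_eqF // (phi_gt0 hphi).
  rewrite mulrCA divff // mulr1 -[RHS](expectation_cst (P x)).
  apply: (eq_expectation_full_set mA PA) => w /= Xw.
  rewrite threshold_time_start ?Xw //= mulr0 oppr0 expR0 mulr1.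
  by rewrite indicE mem_set ?mulr1 //= threshold_time_start ?Xw ?ltry.
rewrite mulrCA EFinM -(phi_hitting hphi lrx lrp (ltW px)).
rewrite -ge0_expectationZl; last by move=> w; exact: discount_ge0.
apply: (eq_expectation_full_set mA PA) => w /= Xw.
have cw : {within `[0, +oo[, continuous (fun t => X t w)}.
  exact: (diffusion_continuous hX).
have tE : threshold_time X p w = hitting_time X p w.
  by apply: threshold_time_eq_hitting_time => //; rewrite Xw ltW.
rewrite tE indicE.
have [/set_mem /=|/negP nfin] := boolP (w \in _).
  by rewrite tE => hoo; rewrite position_at_hitting_time // mulr1.
(* If [p] is never hit, the discount at [+oo] is 0, so both integrands vanish whatever the path does
   at the default time [fine +oo]. *)
suff -> : hitting_time X p w = +oo%E by rewrite /= !mulr0 ?mul0r.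
apply/eqP; rewrite -leye_eq leNgt; apply/negP => hoo.
by apply: nfin; apply/mem_set; rewrite /= tE.
Qed.

Arguments expected_payoff_threshold_time {R d T l r D a sigma X P rho phi} g {x p}.

Theorem mainTheorem4 (R : realType) (d : measure_display)
    (T : measurableType d) (l r : \bar R) (D : set R) (a sigma : R -> R)
    (X : R -> T -> R) (P : R -> probability T R)
    (rho : R) (phi g : R -> R) (x0 pstar : R)
    (hX : regular_diffusion l r D a sigma X P)
    (hrho : 0 < rho)
    (hphi : decreasing_fundamental_solution l r a sigma X P rho phi)
    (hx0 : open_itv l r x0) (hg : 0 < g x0)
    (hpstar : open_itv l r pstar) :
  (forall x, open_itv l r x ->
     optimal_in (threshold_times l r X) (expected_payoff X P g rho x)
       (threshold_time X pstar))
  <->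
  (forall p, open_itv l r p -> pstar < p ->
     g p / phi p <= g pstar / phi pstar) /\
  (forall p q, open_itv l r p -> open_itv l r q -> p <= q -> q <= pstar ->
     g p / phi p <= g q / phi q).
Proof.
(* The common factor [phi x > 0] cancels, which turns optimality at a fixed [x] into an inequality
   between real quotients. *)
have optP x : open_itv l r x ->
    optimal_in (threshold_times l r X) (expected_payoff X P g rho x)
      (threshold_time X pstar) <->
    forall p, open_itv l r p ->
      g (Num.min x p) / phi (Num.min x p) <=
      g (Num.min x pstar) / phi (Num.min x pstar).
  move=> lrx; have payoffE := expected_payoff_threshold_time g hX hphi lrx.
  have phix := phi_gt0 hphi lrx.
  split=> [[_ opt] p lrp|opt].
    rewrite -(ler_pM2l phix) -lee_fin -!payoffE // opt.
    by apply: ereal_sup_ubound; exists (threshold_time X p) => //; exists p.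
  split; first by exists pstar.
  apply/eqP; rewrite eq_le; apply/andP; split.
    apply: ereal_sup_ubound; exists (threshold_time X pstar) => //.
    by exists pstar.
  apply: ge_ereal_sup => _ [_ [p lrp <-] <-].
  by rewrite !payoffE // lee_fin ler_pM2l // opt.
split=> [opt|[gt_pstar le_pstar] x lrx].
  split=> [p lrp pp|p q lrp lrq pq qp].
    have /(optP _ lrp) /(_ _ lrp) := opt _ lrp.
    by rewrite minxx min_r // ltW.
  have /(optP _ lrq) /(_ _ lrp) := opt _ lrq.
  by rewrite min_r // min_l.
apply/(optP _ lrx) => p lrp.
have lrm : open_itv l r (Num.min x p) by case: leP.
(* If [x <= pstar], then [min x p <= x <= pstar] and condition 2 applies. Otherwise the right side
   is the quotient at [pstar], and the side of [pstar] on which [min x p] lies selects the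
   condition. *)
have [xp|px] := leP x pstar.
  by apply: le_pstar => //; rewrite ge_min lexx.
by have [mp|pm] := leP (Num.min x p) pstar; [exact: le_pstar|exact: gt_pstar].
Qed.
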